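(* Let $K=\{x\in\mathbb{R}^n : x_i\ge 0 \text{ for all } i=1,\dots,n\}$ be the positive cone of $\mathbb{R}^n$, let $P_K:\mathbb{R}^n\to K$ be the metric projection onto $K$, and let $\bar x\in\mathbb{R}^n$. Then the regular coderivative of $P_K$ at $\bar x$ is given by $$\widehat D^\ast P_K(\bar x)(y)=\left\{z\in \mathbb{R}^n:\ z_i=y_i \text{ for } i\in \bar x^+;\ z_i=0 \text{ for } i\in \bar x^-;\ 0\leq z_i\leq y_i \text{ for } i\in \bar x^\bullet\right\}\quad\text{for all } y\in\mathbb{R}^n.$$
   Context: $\mathbb{R}^n$ carries the Euclidean inner product $\langle\cdot,\cdot\rangle$ and norm $\|\cdot\|$. For $x\in\mathbb{R}^n$, put $x^+=\{i\in\{1,\dots,n\}: x_i>0\}$, $x^-=\{i\in\{1,\dots,n\}: x_i<0\}$, $x^\bullet=\{i\in\{1,\dots,n\}: x_i=0\}$. For a nonempty closed convex subset $C$ of a Hilbert space $H$, the metric projection $P_C:H\to C$ sends $x$ to the unique $y\in C$ with $\|x-y\|=\inf_{z\in C}\|x-z\|$. For a nonempty subset $\Omega$ of a Hilbert space $H$ and $\bar x\in\Omega$, the Fréchet (regular) normal cone is $$\widehat N_\Omega(\bar x)=\Big\{z\in H:\ \limsup_{u\to\bar x,\ u\in\Omega}\frac{\langle z,u-\bar x\rangle}{\|u-\bar x\|}\le 0\Big\}$$ and $\widehat N_\Omega(\bar x)=\emptyset$ if $\bar x\notin\Omega$. The product $H\times H$ carries the inner product $\langle (x,y),(u,v)\rangle=\langle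 x,u\rangle+\langle y,v\rangle$. For a single-valued map $\Phi:H\to H$ with graph $\mathrm{gph}\,\Phi=\{(x,\Phi(x)):x\in H\}$, the regular coderivative of $\Phi$ at $\bar x$ is the set-valued map $$\widehat D^\ast\Phi(\bar x)(y)=\{z\in H:\ (z,-y)\in\widehat N_{\mathrm{gph}\,\Phi}(\bar x,\Phi(\bar x))\},\quad y\in H.$$ *)

(* Defs.v *)
From HB Require Import structures.
From mathcomp Require Import all_boot all_order all_algebra.
From mathcomp Require Import all_classical all_reals all_analysis.

Set Implicit Arguments.
Unset Strict Implicit.
Unset Printing Implicit Defensive.

Import Order.TTheory GRing.Theory Num.Theory.

Local Open Scope classical_set_scope.
Local Open Scope ring_scope.

(* A Hilbert space is given by its underlying module V and its inner product
   [ip].  Norm and convergence are taken from [ip] because the norm that the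
   library puts on 'rV[R]_n is the sup norm, and on a product the max norm. *)
Section InnerProduct.
Context {R : realType} {V : lmodType R}.
Variable ip : V -> V -> R.

Definition ipnorm (x : V) : R := Num.sqrt (ip x x).

(* C is meant to be nonempty, closed and convex in a complete space, in which
   case the set below is a singleton; the default value 0 is then not used. *)
Definition metric_proj (C : set V) (x : V) : V :=
  xget 0 [set y | C y /\ ipnorm (x - y) = inf [set ipnorm (x - z) | z in C]].

(* V with the neighbourhoods of the norm [ipnorm]. *)
Definition ip_space (_ : V -> V -> R) : Type := V.
Local Notation H := (ip_space ip).
HB.instance Definition _ := GRing.Lmodule.on H.

Definition ip_nbhs (x : H) : set_system H :=
  filter_from [set e : R | 0 < e] (fun e => [set u | ipnorm (u - x) < e]).
HB.instance Definition _ := hasNbhs.Build H ip_nbhs.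

(* The limsup is over u in Omega distinct from xbar; it is -oo when xbar is an
   isolated point of Omega. *)
Definition frechet_normal_cone (Omega : set V) (xbar : V) : set V :=
  [set z | Omega xbar /\
    (limf_esup
       (fun u : H => (ip z (u - xbar) / ipnorm (u - xbar))%:E)
       (within (Omega `\ xbar) (nbhs (xbar : H))) <= 0)%E].

Definition prod_ip (p q : V * V) : R := ip p.1 q.1 + ip p.2 q.2.

End InnerProduct.

Definition gph {V : Type} (Phi : V -> V) : set (V * V) :=
  [set (x, Phi x) | x in [set: V]].

Definition regular_coderivative {R : realType} {V : lmodType R}
    (ip : V -> V -> R) (Phi : V -> V) (xbar y : V) : set V :=
  [set z | frechet_normal_cone (prod_ip ip) (gph Phi) (xbar, Phi xbar) (z, - y)].

Section EuclideanSpace.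
Context {R : realType} {n : nat}.

Definition dotv (x y : 'rV[R]_n) : R := \sum_(i < n) x 0 i * y 0 i.

Definition pos_cone : set 'rV[R]_n := [set x | forall i, 0 <= x 0 i].

Definition pos_idx (x : 'rV[R]_n) : set 'I_n := [set i | 0 < x 0 i].
Definition neg_idx (x : 'rV[R]_n) : set 'I_n := [set i | x 0 i < 0].
Definition zero_idx (x : 'rV[R]_n) : set 'I_n := [set i | x 0 i = 0].

End EuclideanSpace.

(* Main.v *)
Require Import Defs.
From HB Require Import structures.
From mathcomp Require Import all_boot all_order all_algebra.
From mathcomp Require Import all_classical all_reals all_analysis.
From mathcomp Require Import lra.

Set Implicit Arguments.
Unset Strict Implicit.
Unset Printing Implicit Defensive.

Import Order.TTheory GRing.Theory Num.Theory.

Local Open Scope classical_set_scope.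
Local Open Scope ring_scope.

(** The projection onto the positive cone acts coordinatewise by the scalar map
    t |-> max t 0: for v in the cone, the coordinatewise inequality
    (a - p)^2 + (b - p)^2 <= (a - b)^2, where p = max a 0 and b >= 0, sums to
    |x - p|^2 + |v - p|^2 <= |x - v|^2, so that p is the only nearest point
    ([metric_proj_pos_cone]).  Hence (z, - y) is normal to the graph at xbar iff
    the sum over i of z_i h_i - y_i (max (x_i + h_i) 0 - max x_i 0) is at most
    o(|h|).

    If z is in the described box, every summand is <= 0 as soon as |h_i| < |x_i|
    for all nonzero x_i: then max is the identity near x_i > 0 and vanishes near
    x_i < 0, while at x_i = 0 both branches have the right sign
    ([box_term_le]).

    Conversely the graph contains short segments issued from its point at xbar,
    and a Frechet normal has nonpositive inner product with the direction of
    such a segment, because the quotient of the limsup is constant along it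
    ([frechet_normal_cone_segment]).  The directions (e_i, e_i) and
    (- e_i, - e_i) for x_i > 0, (e_i, 0) and (- e_i, 0) for x_i < 0, and
    (e_i, e_i) and (- e_i, 0) for x_i = 0 give exactly the stated
    conditions. *)

(** * Frechet normals *)

Section FrechetNormalCone.
Context {R : realType} {V : lmodType R}.
Variable ip : V -> V -> R.
Implicit Types (Omega : set V) (x z u v : V).

(** The quotient is kept as it stands, since without definiteness of [ip] its
    denominator may vanish at a point other than [x]. *)
Lemma frechet_normal_coneP Omega x z :
  frechet_normal_cone ip Omega x z <->
  Omega x /\ forall e : R, 0 < e -> exists2 d : R, 0 < d &
    forall u, Omega u -> u <> x -> ipnorm ip (u - x) < d ->
      ip z (u - x) / ipnorm ip (u - x) <= e.
Proof.
split=> -[Ox zN]; split => //.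
- move=> e e0.
  have [_ [W [d d0 dW] <-] We] : exists2 s,
      [set ereal_sup ((fun u : ip_space ip =>
         (ip z (u - x) / ipnorm ip (u - x))%:E) @` W) |
         W in within (Omega `\ x) (nbhs (x : ip_space ip))] s & (s < e%:E)%E.
    by apply: ereal_inf_lt; apply: le_lt_trans zN _; rewrite lte_fin.
  exists d => // u Ou ux ud; rewrite -lee_fin.
  apply: le_trans (ltW We); apply: ereal_sup_ubound.
  by exists u => //; apply: dW.
- apply/lee_addgt0Pr => e /zN[d d0 de]; rewrite add0e.
  apply: ge_ereal_inf; eexists.
    exists [set u | Omega u /\ u <> x /\ ipnorm ip (u - x) < d]; last by [].
    by exists d => // u /= ud [Ou ux].
  apply: ge_ereal_sup => _ [u [Ou [ux ud]] <-].
  by rewrite lee_fin; apply: de.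
Qed.

(** Along the segment, the quotient in the definition of the normal cone is the
    constant [ip z v / ipnorm ip v], which a limsup <= 0 forces to be <= 0. *)
Lemma frechet_normal_cone_segment Omega x z v (d0 : R) :
  (forall (t : R) u w, ip (t *: u) w = t * ip u w) ->
  (forall (t : R) u w, ip u (t *: w) = t * ip u w) ->
  0 < ipnorm ip v -> 0 < d0 ->
  (forall t, 0 < t -> t < d0 -> Omega (x + t *: v)) ->
  frechet_normal_cone ip Omega x z -> ip z v <= 0.
Proof.
move=> ipZl ipZr v0 d00 Oxv /frechet_normal_coneP[_ zN].
have normZ t : 0 < t -> ipnorm ip (t *: v) = t * ipnorm ip v.
  move=> t0; rewrite /ipnorm ipZl ipZr mulrA -expr2 sqrtrM ?sqr_ge0//.
  by rewrite sqrtr_sqr gtr0_norm.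
apply/ler_addgt0Pr => e e0; rewrite add0r.
have [d d_gt0 zd] := zN (e / ipnorm ip v) (divr_gt0 e0 v0).
pose t := Num.min d0 (d / ipnorm ip v) / 2.
have dv0 : 0 < d / ipnorm ip v by rewrite divr_gt0.
have m0 : 0 < Num.min d0 (d / ipnorm ip v) by rewrite lt_min d00.
have t0 : 0 < t by rewrite divr_gt0.
have tm : t < Num.min d0 (d / ipnorm ip v) by rewrite /t; lra.
move: tm; rewrite lt_min => /andP[td0 td].
have := zd _ (Oxv t t0 td0).
rewrite addrAC subrr add0r ipZr normZ// -ltr_pdivlMr//.
rewrite -mulf_div divff ?gt_eqF// mul1r ler_pM2r ?invr_gt0//; apply => //.
move=> /eqP; rewrite -subr_eq0 addrAC subrr add0r => /eqP tv0.
have := mulr_gt0 t0 v0.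
by rewrite -normZ// tv0 -(scale0r v) /ipnorm ipZl mul0r sqrtr0 ltxx.
Qed.

End FrechetNormalCone.

(** * The Euclidean inner product *)

Section Dotv.
Context {R : realType} {n : nat}.
Implicit Types (x y h : 'rV[R]_n) (p q : 'rV[R]_n * 'rV[R]_n).

Lemma dotvZl (t : R) x y : dotv (t *: x) y = t * dotv x y.
Proof. by rewrite /dotv mulr_sumr; apply: eq_bigr => i _; rewrite mxE mulrA. Qed.

Lemma dotvZr (t : R) x y : dotv x (t *: y) = t * dotv x y.
Proof. by rewrite /dotv mulr_sumr; apply: eq_bigr => i _; rewrite mxE mulrCA. Qed.

Lemma dotv_delta x i : dotv x (delta_mx 0 i) = x 0 i.
Proof.
rewrite /dotv (bigD1 i)//= mxE !eqxx mulr1 big1 ?addr0// => j ji.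
by rewrite mxE (negbTE ji) andbF mulr0.
Qed.

Lemma dotv_ge0 x : 0 <= dotv x x.
Proof. by apply: sumr_ge0 => i _; rewrite -expr2 sqr_ge0. Qed.

Lemma dotv_eq0 x : dotv x x = 0 -> x = 0.
Proof.
move=> /eqP; rewrite psumr_eq0 => [|i _]; last by rewrite -expr2 sqr_ge0.
move=> /allP x0; apply/rowP => i; rewrite mxE; apply/eqP.
by have := x0 i (mem_index_enum i); rewrite -expr2 sqrf_eq0.
Qed.

Lemma prod_dotvZl (t : R) p q :
  prod_ip dotv (t *: p) q = t * prod_ip dotv p q.
Proof. by rewrite /prod_ip !dotvZl mulrDr. Qed.

Lemma prod_dotvZr (t : R) p q :
  prod_ip dotv p (t *: q) = t * prod_ip dotv p q.
Proof. by rewrite /prod_ip !dotvZr mulrDr. Qed.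

Lemma coord_le_ipnorm p i : `|p.1 0 i| <= ipnorm (prod_ip dotv) p.
Proof.
rewrite -sqrtr_sqr ler_sqrt ?addr_ge0 ?dotv_ge0//.
rewrite -[leLHS]addr0 lerD ?dotv_ge0// /dotv (bigD1 i)//= expr2 lerDl.
by apply: sumr_ge0 => j _; rewrite -expr2 sqr_ge0.
Qed.

End Dotv.

(** * Projection onto the positive cone *)

Section Projection.
Context {R : realType} {n : nat}.
Implicit Types (x y z : 'rV[R]_n).

Definition pos_part x : 'rV[R]_n := \row_i Num.max (x 0 i) 0.

Lemma pos_cone_pos_part x : pos_cone (pos_part x).
Proof. by move=> i; rewrite mxE le_max lexx orbT. Qed.

(** A strengthening of minimality of the distance which also yields uniqueness
    of the minimiser: the angle at [pos_part x] is obtuse. *)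
Lemma pos_part_obtuse x v : pos_cone v ->
  dotv (x - pos_part x) (x - pos_part x) + dotv (v - pos_part x) (v - pos_part x)
    <= dotv (x - v) (x - v).
Proof.
move=> v0; rewrite /dotv -big_split/=; apply: ler_sum => i _; rewrite !mxE.
have := v0 i; have [x0|x0] := leP (x 0 i) 0; nra.
Qed.

Lemma metric_proj_pos_cone x : metric_proj dotv pos_cone x = pos_part x.
Proof.
have inf_dist : inf [set ipnorm dotv (x - v) | v in pos_cone] =
    ipnorm dotv (x - pos_part x).
  have lb : lbound [set ipnorm dotv (x - v) | v in pos_cone]
      (ipnorm dotv (x - pos_part x)).
    move=> _ [v v0 <-]; rewrite ler_sqrt ?dotv_ge0//.
    by apply: le_trans (pos_part_obtuse x v0); rewrite lerDl dotv_ge0.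
  have mem : [set ipnorm dotv (x - v) | v in pos_cone]
      (ipnorm dotv (x - pos_part x)).
    by exists (pos_part x) => //; exact: pos_cone_pos_part.
  apply/eqP; rewrite eq_le; apply/andP; split.
    by apply: ge_inf mem; exists (ipnorm dotv (x - pos_part x)).
  by apply: lb_le_inf lb; exists (ipnorm dotv (x - pos_part x)).
apply: xget_unique => [|v [v0]]; rewrite inf_dist.
  by split => //; exact: pos_cone_pos_part.
move=> /(congr1 (fun a => a ^+ 2)); rewrite !sqr_sqrtr ?dotv_ge0// => eqd.
have := pos_part_obtuse x v0; rewrite eqd gerDl => le0.
by apply/eqP; rewrite -subr_eq0; apply/eqP/dotv_eq0/le_anti; rewrite le0 dotv_ge0.
Qed.

End Projection.

(** * The coderivative *)

Section Coderivative.
Context {R : realType} {n : nat}.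
Implicit Types (x y z : 'rV[R]_n).

(** [r] is the slope at [x 0 i], in the direction [s], of the scalar projection.
    It is only asked to be exact on a short interval, so that both branches of
    the maximum are treated alike; as [pos_part] acts coordinatewise, the graph
    then contains a segment in the direction (s e_i, r e_i). *)
Lemma regular_coderivative_axis x y z i (s r d : R) :
  regular_coderivative dotv (@pos_part R n) x y z ->
  s != 0 -> 0 < d ->
  (forall t, 0 < t -> t < d ->
     Num.max (x 0 i + t * s) 0 = Num.max (x 0 i) 0 + t * r) ->
  s * z 0 i <= r * y 0 i.
Proof.
move=> zN s0 d0 seg.
pose v : 'rV[R]_n * 'rV[R]_n := (s *: delta_mx 0 i, r *: delta_mx 0 i).
have v_gt0 : 0 < ipnorm (prod_ip dotv) v.
  apply: lt_le_trans (coord_le_ipnorm v i).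
  by rewrite normr_gt0 !mxE !eqxx mulr1.
have graph t : 0 < t -> t < d ->
    gph (@pos_part R n) ((x, pos_part x) + t *: v).
  move=> t0 td; exists (x + t *: (s *: delta_mx 0 i)) => //; congr (_, _).
  apply/rowP => j; rewrite !mxE /=; have [->|ji] := eqVneq j i.
    by rewrite !mulr1 seg.
  by rewrite !mulr0 !addr0.
have := frechet_normal_cone_segment (@prod_dotvZl R n) (@prod_dotvZr R n)
  v_gt0 d0 graph zN.
rewrite /prod_ip /= !dotvZr !dotv_delta mxE; lra.
Qed.

(** One coordinate of the converse: the increment [h] is too small to change the
    sign of a nonzero [a], so the maximum stays on one of its two branches; at
    [a = 0] the right-hand side is [b * h] or [0] according to the sign of
    [h]. *)
Lemma box_term_le (a b c h : R) :
  (0 < a -> c = b) -> (a < 0 -> c = 0) -> (a = 0 -> 0 <= c <= b) ->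
  (a != 0 -> `|h| < `|a|) ->
  c * h <= b * (Num.max (a + h) 0 - Num.max a 0).
Proof.
move=> pos neg zero; have [a0|a0|a0] := ltgtP a 0.
- rewrite neg// (ltr0_norm a0) => /(_ isT); rewrite ltr_norml => /andP[_ ha].
  by rewrite max_r ?subrr; lra.
- rewrite pos// (gtr0_norm a0) => /(_ isT); rewrite ltr_norml => /andP[ha _].
  by rewrite max_l; lra.
- move: (zero a0) => /andP[c0 cb] _; rewrite a0 add0r subr0.
  by have [h0|h0] := leP h 0; nra.
Qed.

Lemma nonzero_coord_lbound x :
  exists2 d : R, 0 < d & forall i, x 0 i != 0 -> d <= `|x 0 i|.
Proof.
exists (\big[Num.min/1]_(i | x 0 i != 0) `|x 0 i|).
  by apply: lt_bigmin => // i; rewrite normr_gt0.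
by move=> i xi; apply: bigmin_le_cond.
Qed.

End Coderivative.

Theorem theorem3p1 (R : realType) (n : nat) (xbar y : 'rV[R]_n) :
  regular_coderivative dotv (metric_proj dotv pos_cone) xbar y =
  [set z : 'rV[R]_n |
    [/\ forall i, pos_idx xbar i -> z 0 i = y 0 i,
        forall i, neg_idx xbar i -> z 0 i = 0 &
        forall i, zero_idx xbar i -> 0 <= z 0 i <= y 0 i]].
Proof.
rewrite (funext (@metric_proj_pos_cone R n)).
apply/seteqP; split=> z.
- move=> /regular_coderivative_axis ax; split=> i xi.
  + have le1 : 1 * z 0 i <= 1 * y 0 i.
      apply: (ax i 1 1 _ _ xi); first by rewrite oner_eq0.
      by move=> t t0 tx; rewrite !max_l; lra.
    have le2 : -1 * z 0 i <= -1 * y 0 i.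
      apply: (ax i (-1) (-1) _ _ xi); first by rewrite oppr_eq0 oner_eq0.
      by move=> t t0 tx; rewrite !max_l; lra.
    lra.
  + have mx0 : 0 < - xbar 0 i by rewrite oppr_gt0.
    have le1 : 1 * z 0 i <= 0 * y 0 i.
      apply: (ax i 1 0 _ _ mx0); first by rewrite oner_eq0.
      by move=> t t0 tx; rewrite !max_r; lra.
    have le2 : -1 * z 0 i <= 0 * y 0 i.
      apply: (ax i (-1) 0 _ _ mx0); first by rewrite oppr_eq0 oner_eq0.
      by move=> t t0 tx; rewrite !max_r; lra.
    lra.
  + have le1 : 1 * z 0 i <= 1 * y 0 i.
      apply: (ax i 1 1 1 _ ltr01); first by rewrite oner_eq0.
      by move=> t t0 _; rewrite xi maxxx max_l; lra.
    have le2 : -1 * z 0 i <= 0 * y 0 i.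
      apply: (ax i (-1) 0 1 _ ltr01); first by rewrite oppr_eq0 oner_eq0.
      by move=> t t0 _; rewrite xi maxxx max_r; lra.
    by apply/andP; split; lra.
- move=> [zpos zneg zzero]; apply/frechet_normal_coneP; split.
    by exists xbar.
  have [d d0 dx] := nonzero_coord_lbound xbar.
  move=> e e0; exists d => // _ [u _ <-] _ ud.
  apply: le_trans (ltW e0); apply: mulr_le0_ge0; last first.
    by rewrite invr_ge0 sqrtr_ge0.
  (* The numerator itself is <= 0 near [xbar], so one [d] serves every [e]. *)
  rewrite /prod_ip /dotv -big_split/=; apply: sumr_le0 => i _.
  have near : xbar 0 i != 0 -> `|u 0 i - xbar 0 i| < `|xbar 0 i|.
    move=> /dx; apply: lt_le_trans; apply: le_lt_trans ud.
    by have := coord_le_ipnorm ((u, pos_part u) - (xbar, pos_part xbar)) i;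
      rewrite !mxE.
  have := box_term_le (zpos i) (zneg i) (zzero i) near.
  by rewrite !mxE subrKC; lra.
Qed.
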